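(* Let $n\geq 1$ and let $\mathcal{W}_n=\{|D(X)|:X\in(\mathbb{Z}/2\mathbb{Z})^n\}$. Then \[ \mathcal{W}_n=\{z(n+1-z):1\leq z\leq n+1\}, \] where $z$ ranges over integers. Moreover, for each integer $z$ with $1\leq z\leq n+1$, the number of sequences $X\in(\mathbb{Z}/2\mathbb{Z})^n$ whose prefix-parity sequence contains exactly $z$ zeros is $\binom{n}{z-1}$. More precisely, for $w\in\mathcal{W}_n$, let \[ \mathcal{Z}_n(w)=\{z\in\{1,\ldots,n+1\}:z(n+1-z)=w\}. \] Then \[ \#\{X\in(\mathbb{Z}/2\mathbb{Z})^n:|D(X)|=w\}=\sum_{z\in\mathcal{Z}_n(w)}\binom{n}{z-1}. \]
   Context: For $X=(a_0,\ldots,a_{n-1})\in(\mathbb{Z}/2\mathbb{Z})^n$, the (binary) Delannoy--Steinhaus triangle $D(X)=(a_{i,j})$ is defined for $0\leq i\leq n-1$ and $0\leq j\leq n-i-1$ by $a_{0,j}=a_j$ and, in $\mathbb{Z}/2\mathbb{Z}$, \[ a_{1,j}=a_{0,j}+a_{0,j+1}\quad(0\leq j\leq n-2), \] \[ a_{i+1,j}=a_{i,j}+a_{i,j+1}+a_{i-1,j+1}\quad(1\leq i\leq n-2,\ 0\leq j\leq n-i-2). \] The weight $|D(X)|$ is the number of entries $a_{i,j}$ of the triangle (all rows, including row $0$) equal to $1$. The prefix-parity sequence of $X$ is $P=(P_0,\ldots,P_n)\in(\mathbb{Z}/2\mathbb{Z})^{n+1}$ with $P_0=0$ and $P_r=\sum_{h=0}^{r-1}a_h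 \pmod 2$ for $1\leq r\leq n$. *)

(* Defs.v *)
From mathcomp Require Import all_boot all_algebra.

Set Implicit Arguments.
Unset Strict Implicit.
Unset Printing Implicit Defensive.

Import GRing.Theory.
Local Open Scope ring_scope.

(* The local rule on N x N. For i + j < n, entry (i, j) depends only on
   x 0, ..., x (n - 1), so the values of x past the end of a sequence never
   reach the triangle. *)
Fixpoint ds_entry (x : nat -> 'Z_2) (i j : nat) {struct i} : 'Z_2 :=
  match i with
  | 0 => x j
  | i1.+1 =>
    match i1 with
    | 0 => ds_entry x i1 j + ds_entry x i1 j.+1
    | i2.+1 => ds_entry x i1 j + ds_entry x i1 j.+1 + ds_entry x i2 j.+1
    end
  end.

(* The index set 0 <= i <= n - 1, 0 <= j <= n - i - 1 is {(i, j) | i + j < n}. *)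
Definition ds_index (n : nat) : {set 'I_n * 'I_n} :=
  [set p : 'I_n * 'I_n | (p.1 + p.2 < n)%N].

Definition ds_weight (n : nat) (X : n.-tuple 'Z_2) : nat :=
  #|[set p in ds_index n | ds_entry (nth 0 X) p.1 p.2 == 1]|.

Definition ds_weights (n : nat) : pred nat :=
  [pred w | [exists X : n.-tuple 'Z_2, ds_weight X == w]].

Definition prefix_parity (n : nat) (X : n.-tuple 'Z_2) : n.+1.-tuple 'Z_2 :=
  [tuple \sum_(h < r) X`_h | r < n.+1].

Definition zero_counts (n w : nat) : {set 'I_n.+2} :=
  [set z : 'I_n.+2 | (1 <= z)%N && (z * (n + 1 - z) == w)%N].

(* Main.v *)
Require Import Defs.
From mathcomp Require Import all_boot all_algebra.
From mathcomp Require Import ring zify.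

(** The whole triangle can be read off the prefix parities. Writing the
    generating row as the differences [P_j + P_(j+1)], the local rule telescopes
    in characteristic 2 and gives [a_(i,j) = P_j + P_(i+j+1)] in every row
    ([ds_entry_prefix]). As [(i, j)] runs over the triangle, [(j, i+j+1)] runs
    exactly once over the pairs of positions [r < s] among [0, ..., n], so the
    weight counts the unordered pairs of positions whose parities differ: with
    [z] zeros among the [n+1] parities, there are [z * (n+1-z)] such pairs
    ([ds_weightE]).

    Conversely [P_0 = 0] always, while the zeros of [P_1, ..., P_n] may be
    placed freely: the set of their positions determines the sequence, and there
    are as many binary sequences of length [n] as subsets of an [n]-set. So
    [z] zeros occur for ['C(n, z-1)] sequences ([card_zeros]). Every [z] from 1
    to [n+1] thus occurs, and a given weight [w] is reached exactly by the
    sequences whose number [z] of zeros satisfies [z * (n+1-z) = w]. *)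

Set Implicit Arguments.
Unset Strict Implicit.
Unset Printing Implicit Defensive.

Import GRing.Theory.
Local Open Scope nat_scope.

Definition prefix_sum (x : nat -> 'Z_2) (r : nat) : 'Z_2 := (\sum_(h < r) x h)%R.

Lemma prefix_sumS x r : (prefix_sum x r.+1 = prefix_sum x r + x r)%R.
Proof. exact: big_ord_recr. Qed.

Lemma prefix_sum0 x : prefix_sum x 0 = 0%R.
Proof. exact: big_ord0. Qed.

Lemma addZ2_eq1 (a b : 'Z_2) : ((a + b)%R == 1%R) = ((a == 0%R) != (b == 0%R)).
Proof. by case: a b => [[|[|//]] ?] [[|[|//]] ?]. Qed.

Lemma Z2_eq0_inj (a b : 'Z_2) : (a == 0%R) = (b == 0%R) -> a = b.
Proof.
by case: a b => [[|[|//]] ha] [[|[|//]] hb] // _; apply: val_inj.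
Qed.

(** The local rule looks back two rows, so rows [i] and [i+1] are carried
    together through the induction; in the next entry, the terms [P_(j+1)] and
    [P_(i+j+2)] each occur twice and cancel. *)
Lemma ds_entry_prefix x i j :
  ds_entry x i j = (prefix_sum x j + prefix_sum x (i + j).+1)%R.
Proof.
have addZ2 (a : 'Z_2) : (a + a = 0)%R.
  by apply/val_inj; case: a => [[|[|//]] ?].
suff H : forall k, ds_entry x i k = (prefix_sum x k + prefix_sum x (i + k).+1)%R
    /\ ds_entry x i.+1 k = (prefix_sum x k + prefix_sum x (i.+1 + k).+1)%R.
  by case: (H j).
elim: i => [|i IH] k.
  rewrite /= add0n add1n !prefix_sumS addrA addZ2 add0r; split=> //.
  by rewrite !addrA addZ2 add0r.
have [_ E1] := IH k; split=> //.
have [E0 E2] := IH k.+1.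
have -> : ds_entry x i.+2 k
    = (ds_entry x i.+1 k + ds_entry x i.+1 k.+1 + ds_entry x i k.+1)%R by [].
rewrite E1 E2 E0 !addnS !addSn.
set a := prefix_sum x k; set b := prefix_sum x _; set c := prefix_sum x k.+1.
set d := prefix_sum x _.
have -> : (a + b + (c + d) + (c + b) = a + d + (b + b) + (c + c))%R by ring.
by rewrite !addZ2 !addr0.
Qed.

Definition zero_set n (X : n.-tuple 'Z_2) : {set 'I_n.+1} :=
  [set r : 'I_n.+1 | prefix_sum (nth 0%R X) r == 0%R].

Lemma count_zero_set n (X : n.-tuple 'Z_2) :
  count_mem 0%R (prefix_parity X) = #|zero_set X|.
Proof.
rewrite /= count_map enumT cardE /enum_mem size_filter.
by apply: eq_count => r; rewrite /= inE.
Qed.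

(** By [ds_entry_prefix], an entry is 1 exactly when one of the parities at
    [j] and [i+j+1] is zero and the other is not. Listing the zero first matches
    the ones of the triangle with the product of [zero_set X] and its
    complement; the smaller position of a pair is [j], so the match is
    one-to-one. *)
Lemma ds_weightE n (X : n.-tuple 'Z_2) :
  ds_weight X = #|zero_set X| * (n + 1 - #|zero_set X|).
Proof.
set P := prefix_sum (nth 0%R X).
have -> : n + 1 - #|zero_set X| = #|~: zero_set X|.
  by have := cardsC (zero_set X); rewrite card_ord; lia.
rewrite -cardsX /ds_weight.
pose f (p : 'I_n * 'I_n) : 'I_n.+1 * 'I_n.+1 :=
  let r := inord p.2 in let s := inord (p.1 + p.2).+1 in
  if P p.2 == 0%R then (r, s) else (s, r).
rewrite -(card_in_imset (f := f)); last first.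
  move=> [i j] [i' j']; rewrite !inE /= => /andP[lij _] /andP[lij' _].
  have [? ? ? ?] : [/\ j < n.+1, j' < n.+1, (i + j).+1 < n.+1 & (i' + j').+1 < n.+1].
    by split; lia.
  rewrite /f /=; case: ifP => _; case: ifP => _ [] /(congr1 val) + /(congr1 val);
    rewrite /= !inordK // => e1 e2; congr pair; apply: val_inj => /=; lia.
apply: eq_card => -[r s]; rewrite !inE /=; apply/imsetP/andP.
  case=> -[i j]; rewrite !inE /= ds_entry_prefix addZ2_eq1 -/P => /andP[lij ne].
  have [? ?] : j < n.+1 /\ (i + j).+1 < n.+1 by split; lia.
  have {ne}Ps : (P (i + j).+1 == 0%R) = ~~ (P j == 0%R).
    by case: (P j == 0%R) ne; case: (P _ == 0%R).
  rewrite /f /=; case: (boolP (P j == 0%R)) Ps => Pj Ps [-> ->];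
    by rewrite !inordK // -/P Ps.
case=> Pr Ps.
have ne : r != s :> nat by apply: contraNneq Ps => <-.
have lr := ltn_ord r; have ls := ltn_ord s.
have [lrs|lsr|e] := ltngtP r s; last by rewrite e eqxx in ne.
  have hi : s - r.+1 < n by lia.
  have hj : r < n by lia.
  exists (Ordinal hi, Ordinal hj); rewrite ?inE /= ?ds_entry_prefix ?addZ2_eq1 /f /=.
    have -> : (s - r.+1 + r).+1 = s by lia.
    by rewrite (eqP Pr) (negPf Ps) andbT; lia.
  have -> : (s - r.+1 + r).+1 = s by lia.
  by rewrite /P Pr !inord_val.
have hi : r - s.+1 < n by lia.
have hj : s < n by lia.
exists (Ordinal hi, Ordinal hj); rewrite ?inE /= ?ds_entry_prefix ?addZ2_eq1 /f /=.
  have -> : (r - s.+1 + s).+1 = r by lia.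
  by rewrite (eqP Pr) (negPf Ps) andbT; lia.
have -> : (r - s.+1 + s).+1 = r by lia.
by rewrite /P (negPf Ps) !inord_val.
Qed.

(** Position 0, where the parity always vanishes, is left out. *)
Definition free_zero_set n (X : n.-tuple 'Z_2) : {set 'I_n} :=
  [set r | lift ord0 r \in zero_set X].

Lemma card_zero_setS n (X : n.-tuple 'Z_2) :
  #|zero_set X| = #|free_zero_set X|.+1.
Proof.
rewrite -!sum1_card [LHS]big_mkcond big_ord_recl [in RHS]big_mkcond /=.
rewrite inE /= prefix_sum0 eqxx add1n.
by congr _.+1; apply: eq_bigr => r _; rewrite !inE.
Qed.

(** An element of [Z_2] is known once it is known whether it vanishes, so the
    zeros determine all parities, and the differences of consecutive parities
    determine the sequence. Surjectivity then follows by counting. *)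
Lemma free_zero_set_bij n : bijective (@free_zero_set n).
Proof.
apply: inj_card_bij; last first.
  rewrite -[leqLHS]cardsT -powersetT card_powerset cardsT card_tuple.
  by rewrite !card_ord.
move=> X Y eXY.
have eP r : r <= n -> prefix_sum (nth 0%R X) r = prefix_sum (nth 0%R Y) r.
  case: r => [|r] lr; first by rewrite !prefix_sum0.
  have := congr1 (fun A : {set 'I_n} => Ordinal lr \in A) eXY.
  by rewrite !inE; apply: Z2_eq0_inj.
apply/val_inj/(@eq_from_nth _ 0%R); rewrite ?size_tuple // => r lr.
have := eP r.+1 lr; rewrite !prefix_sumS (eP r) 1?ltnW //.
exact: addrI.
Qed.

Lemma card_zeros n z : 0 < z ->
  #|[set X : n.-tuple 'Z_2 | #|zero_set X| == z]| = 'C(n, z - 1).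
Proof.
case: z => // z _; rewrite subn1 /= -[in RHS](card_ord n) -card_draws.
rewrite -(on_card_preimset (onW_bij _ (@free_zero_set_bij n))).
by apply: eq_card => X; rewrite !inE card_zero_setS.
Qed.

Theorem theorem4p1 (n : nat) (hn : 1 <= n) :
  [/\ forall w : nat,
        w \in ds_weights n <->
        exists z : nat, 1 <= z <= n + 1 /\ w = z * (n + 1 - z),
      forall z : nat, 1 <= z <= n + 1 ->
        #|[set X : n.-tuple 'Z_2 | count_mem 0%R (prefix_parity X) == z]|
          = 'C(n, z - 1)
    & forall w : nat, w \in ds_weights n ->
        #|[set X : n.-tuple 'Z_2 | ds_weight X == w]|
          = \sum_(z in zero_counts n w) 'C(n, z - 1)].
Proof.
have zs_le (X : n.-tuple 'Z_2) : 1 <= #|zero_set X| <= n + 1.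
  by rewrite card_zero_setS /= addn1 ltnS -[leqRHS]card_ord max_card.
split=> [w|z /andP[z_gt0 _]|w _].
- split=> [/existsP[X /eqP <-]|[z [/andP[z_gt0 lz] ->]]].
    by exists #|zero_set X|; split; [exact: zs_le | exact: ds_weightE].
  have : 0 < 'C(n, z - 1) by rewrite bin_gt0; lia.
  rewrite -card_zeros // => /card_gt0P[X]; rewrite inE => /eqP eX.
  by apply/existsP; exists X; rewrite ds_weightE eX.
- rewrite -(card_zeros n z_gt0).
  by apply: eq_card => X; rewrite !inE count_zero_set.
pose zc (X : n.-tuple 'Z_2) : 'I_n.+2 := inord #|zero_set X|.
have zcE X : val (zc X) = #|zero_set X|.
  by rewrite /zc /= inordK //; case/andP: (zs_le X) => _; rewrite addn1.
rewrite -sum1_card (partition_big zc (mem (zero_counts n w))) /=; last first.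
  move=> X; rewrite !inE ds_weightE zcE => ->; rewrite andbT.
  by case/andP: (zs_le X).
apply: eq_bigr => z; rewrite inE => /andP[z_gt0 /eqP zw].
rewrite -card_zeros // -sum1_card; apply: eq_bigl => X.
rewrite !inE ds_weightE -(inj_eq val_inj) zcE.
have [->|_] := #|zero_set X| =P val z; last by rewrite andbF.
by rewrite zw eqxx.
Qed.
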